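(* Let $q$ be a prime power, $n>1$ an integer and $p=\mathrm{char}(\mathbb{F}_{q^n})$. Let $t\ge 2$, let $L(x)$ be a $t$-nilpotent linearized polynomial over $\mathbb{F}_{q^n}$ and let $k(x)\in\mathbb{F}_{q^n}[x]$ be any linearized permutation polynomial over $\mathbb{F}_{q^n}$ such that, under the ordinary polynomial composition, $k(L(x))=L(k(x))$. Let $s=\mathcal{O}(k)$. Then: (a) $L(x)+k(x)$ is also a permutation polynomial over $\mathbb{F}_{q^n}$, and its compositional inverse map on $\mathbb{F}_{q^n}$ is given by $$(L+k)^{(-1)}(x)=\sum_{i=0}^{t-1}(-1)^iL^{(i)}\bigl(k^{(s-1-i)}(x)\bigr),$$ where $k^{(0)}(x)=L^{(0)}(x)=x$ and the exponent $s-1-i$ is taken modulo $s$. (b) If $k(x)$ is a complete permutation polynomial over $\mathbb{F}_{q^n}$, then so is $L(x)+k(x)$. (c) $\mathcal{O}(L+k)$ divides $\mathrm{lcm}(s,p^e)$, where $e=\lceil \log_p t\rceil$. (d) If $t=2$ and $\gcd(s,p)=1$, then $\mathcal{O}(L+k)=ps$.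
   Context: A polynomial $L(x)\in \mathbb{F}_{q^n}[x]$ is linearized if it has the form $L(x)=\sum_{i=0}^{k}a_ix^{q^i}$ with $a_i\in\mathbb{F}_{q^n}$. For a polynomial $f$, $f^{(d)}(x)$ denotes the ordinary polynomial composition of $f(x)$ with itself $d$ times. For an integer $t\ge 2$, $L(x)\in\mathbb{F}_{q^n}[x]$ is a $t$-nilpotent linearized polynomial ($t$-NLP) over $\mathbb{F}_{q^n}$ if $L(x)$ is linearized, $L(x)\not\equiv 0\pmod{x^{q^n}-x}$ and $L^{(t)}(x)\equiv 0\pmod{x^{q^n}-x}$. A polynomial $f(x)\in\mathbb{F}_{q^n}[x]$ is a permutation polynomial over $\mathbb{F}_{q^n}$ if $c\mapsto f(c)$ is a permutation of $\mathbb{F}_{q^n}$; it is a complete permutation polynomial if both $f(x)$ and $f(x)+x$ are permutation polynomials. For a permutation polynomial $f$ over $\mathbb{F}_{q^n}$, $\mathcal{O}(f)=\min\{d>0 : f^{(d)}(z)=z \text{ for all } z\in\mathbb{F}_{q^n}\}$. *)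

(* Defs.v *)
From mathcomp Require Import all_boot all_order all_algebra all_fingroup.

Set Implicit Arguments.
Unset Strict Implicit.
Unset Printing Implicit Defensive.

Import GRing.Theory.
Local Open Scope ring_scope.

Definition prime_power (q : nat) : Prop :=
  exists r m : nat, [/\ prime r, (0 < m)%N & q = (r ^ m)%N].

Definition linearized (F : finFieldType) (q : nat) (L : {poly F}) : Prop :=
  exists (k : nat) (a : nat -> F),
    L = \sum_(0 <= i < k.+1) a i *: 'X^(q ^ i).

Definition poly_iter (F : finFieldType) (f : {poly F}) (d : nat) : {poly F} :=
  iter d (fun g => f \Po g) 'X.

(* Reduction is modulo 'X^#|F| - 'X, i.e. x^(q^n) - x when #|F| = q^n. *)
Definition NLP (F : finFieldType) (q t : nat) (L : {poly F}) : Prop :=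
  [/\ linearized q L,
      ~~ ('X^#|F| - 'X %| L) &
      'X^#|F| - 'X %| poly_iter L t].

Definition perm_poly (F : finFieldType) (f : {poly F}) : Prop :=
  bijective (fun c : F => f.[c]).

Definition complete_perm_poly (F : finFieldType) (f : {poly F}) : Prop :=
  perm_poly f /\ perm_poly (f + 'X).

Lemma horner_poly_iter (F : finFieldType) (f : {poly F}) (d : nat) (z : F) :
  (poly_iter f d).[z] = iter d (fun c => f.[c]) z.
Proof.
by elim: d => [|d IHd]; rewrite /poly_iter /= ?hornerX // horner_comp IHd.
Qed.

(* The injectivity guard only makes the minimum exist for every f; the value
   for a non-permutation polynomial is 0. *)
Definition pp_period (F : finFieldType) (f : {poly F}) (d : nat) : bool :=
  injectiveb (fun c : F => f.[c]) ==>
    (0 < d)%N && [forall z : F, (poly_iter f d).[z] == z].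

Lemma pp_period_ex (F : finFieldType) (f : {poly F}) :
  exists d, pp_period f d.
Proof.
have [/injectiveP injf | ninjf] :=
  boolP (injectiveb (fun c : F => f.[c])); last first.
  by exists 0%N; rewrite /pp_period (negPf ninjf).
exists #[perm injf]%g; apply/implyP => _; rewrite order_gt0 /=.
apply/forallP => z; apply/eqP; rewrite horner_poly_iter.
rewrite -[RHS](perm1 z) -(expg_order (perm injf)) permX.
by apply: eq_iter => c; rewrite permE.
Qed.

Definition pp_order (F : finFieldType) (f : {poly F}) : nat :=
  ex_minn (pp_period_ex f).

Lemma pp_orderP (F : finFieldType) (f : {poly F}) : perm_poly f ->
  [/\ (0 < pp_order f)%N,
      (forall z, (poly_iter f (pp_order f)).[z] = z) &
      (forall d, (0 < d)%N -> (forall z, (poly_iter f d).[z] = z) ->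
         (pp_order f <= d)%N)].
Proof.
move=> /bij_inj injf; rewrite /pp_order; case: ex_minnP => m.
have gT : injectiveb (fun c : F => f.[c]) by apply/injectiveP.
rewrite {1}/pp_period gT /= => /andP[m_gt0 /forallP mP] minm; split=> //.
  by move=> z; apply/eqP.
move=> d d_gt0 dP; apply: minm; rewrite /pp_period gT d_gt0 /=.
by apply/forallP => z; apply/eqP.
Qed.

(* Main.v *)
(** A linearized polynomial acts on F as an additive map, that is, as an
    element of the endomorphism ring of F over its prime field, a ring of
    characteristic p.  There L and k become commuting elements with L^t = 0 and
    k^s = 1, so that L + k = k (1 + k^-1 L) is inverted by a finite geometric
    series, and for p^e >= t the Frobenius identity gives
    (L + k)^(p^e) = L^(p^e) + k^(p^e) = k^(p^e), which bounds the order.  When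
    L^2 = 0, (L + k)^d = k^d + d L k^(d-1): if this is 1, raising to the power p
    yields s | dp, hence s | d when p and s are coprime; then d L = 0, so p | d. *)
Require Import Defs.
From HB Require Import structures.
From mathcomp Require Import all_boot all_order all_algebra all_fingroup all_field.

Set Implicit Arguments.
Unset Strict Implicit.
Unset Printing Implicit Defensive.

Import GRing.Theory FalgLfun.
Local Open Scope ring_scope.

(** * Commuting elements of a ring, one of them nilpotent *)

Section CommutingNilpotent.

Variables (R : nzRingType) (l k : R).
Hypothesis lk : GRing.comm l k.

(** The function [j] abstracts the reduced exponents: [k ^+ j i] stands for the inverse of
    [k ^+ i.+1]. With v = k^-1 and u = -lv, one has l + k = (1 - u)k and g = (1 + u + ... +
    u^(t-1))v, and the sum inverts 1 - u because u^t = 0. *)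
Lemma comm_nilpotent_inv (t : nat) (j : nat -> nat)
    (g := \sum_(0 <= i < t) (-1) ^+ i * (l ^+ i * k ^+ j i)) :
    l ^+ t = 0 -> (forall i, k ^+ j i * k ^+ i.+1 = 1) ->
  (l + k) * g = 1 /\ g * (l + k) = 1.
Proof.
move=> lt0 kj; pose v := k ^+ j 0%N.
have vk : v * k = 1 by rewrite -[RHS](kj 0%N).
have cvk : GRing.comm v k by apply: commr_sym; apply: commrX.
have clv : GRing.comm l v by apply: commrX.
have kjE i : k ^+ j i = v ^+ i.+1.
  (* Insert 1 = (kv)^(i+1) on the right, then cancel k^(j i) against k^(i+1). *)
  rewrite -[LHS]mulr1 -[1 in LHS](expr1n R i.+1) -vk cvk exprMn_comm //.
  by rewrite mulrA kj mul1r.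
pose u := - (l * v).
have gE : g = (\sum_(i < t) u ^+ i) * v.
  rewrite /g big_mkord mulr_suml; apply: eq_bigr => i _.
  by rewrite kjE [u ^+ i]exprNn exprMn_comm // exprSr !mulrA.
have lkE : l + k = (1 - u) * k.
  by rewrite opprK mulrDl mul1r -mulrA vk mulr1 addrC.
have cku : GRing.comm k u.
  by apply: commrN; apply: commrM; apply: commr_sym.
have cuv : GRing.comm u v.
  by apply: commr_sym; apply: commrN; apply: commrM => //; apply: commr_sym.
have ut : u ^+ t = 0 by rewrite exprNn exprMn_comm // lt0 mul0r mulr0.
have uS : (1 - u) * \sum_(i < t) u ^+ i = 1.
  by apply: oppr_inj; rewrite -mulNr opprB -subrX1 ut sub0r.
have cS x : GRing.comm x u -> GRing.comm x (\sum_(i < t) u ^+ i).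
  by move=> cx; apply: commr_sum => i _; apply: commrX.
have cu1 x : GRing.comm x u -> GRing.comm x (1 - u).
  by move=> cx; apply: commrB => //; apply: commr1.
rewrite gE lkE; split.
  by rewrite -mulrA [k * _]mulrA (cS k) // -mulrA -cvk vk mulr1.
rewrite -mulrA [v * _]mulrA (cu1 v); last exact: commr_sym.
rewrite -mulrA vk mulr1 cu1 //; apply: commr_sym; exact: cS.
Qed.

Lemma exprD_pchar_comm (p e : nat) :
  p \in [pchar R] -> (l + k) ^+ (p ^ e) = l ^+ (p ^ e) + k ^+ (p ^ e).
Proof.
move=> hp; elim: e => [|e IHe]; first by rewrite !expr1.
rewrite expnSr !exprM IHe -!(pFrobenius_autE hp) pFrobenius_autD_comm //.
by apply: commrX; apply: commr_sym; apply: commrX; apply: commr_sym.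
Qed.

(** The binomial expansion stops after its linear term; the extra factor [k] turns the exponent d -
    1 there into d, so d = 0 is no special case. *)
Lemma exprD_comm_sqr0 (d : nat) :
  l ^+ 2 = 0 -> (l + k) ^+ d * k = k ^+ d.+1 + l * k ^+ d *+ d.
Proof.
move=> l2; elim: d => [|d IHd]; first by rewrite mul1r mulr0n addr0.
rewrite exprS -mulrA IHd mulrDl !mulrDr -!mulrnAr mulrA -expr2 l2 mul0r addr0.
rewrite !mulrnAr [k * (l * _)]mulrA -lk -[l * k * _]mulrA -!exprS mulrS.
by rewrite addrCA.
Qed.

End CommutingNilpotent.

Lemma expr_eq1_dvdn (R : nzRingType) (x : R) (m d : nat) :
    (0 < m)%N -> x ^+ m = 1 ->
    (forall e, (0 < e)%N -> x ^+ e = 1 -> (m <= e)%N) ->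
  (x ^+ d == 1) = (m %| d)%N.
Proof.
move=> m_gt0 xm1 minm; rewrite -(expr_mod d xm1) /dvdn.
have [-> | r_gt0] := posnP (d %% m); first by rewrite expr0 !eqxx.
apply/negbTE/eqP => /(minm _ r_gt0).
by rewrite leqNgt ltn_pmod.
Qed.

(** This makes the reduced exponent s - 1 - i an admissible [j i]. It is computed in the integers
    because i may exceed s - 1; the residue is nonnegative, so the absolute value leaves it
    unchanged. *)
Lemma dvdn_absz_modz_sub (s i : nat) :
  (0 < s)%N -> (s %| `|((s%:Z - 1 - i%:Z) %% s%:Z)%Z|%N + i.+1)%N.
Proof.
move=> s_gt0; have s_neq0 : s%:Z != 0 by rewrite eqz_nat -lt0n.
set r := (_ %% _)%Z.
suff: (s%:Z %| (`|r| + i.+1)%N%:Z)%Z by rewrite dvdzE.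
apply/dvdz_mod0P; rewrite PoszD gez0_abs ?modz_ge0 // modzDml intS.
by rewrite addrACA subrK addNr addr0 modzz.
Qed.

(** * Linearized polynomials as endomorphisms of F over its prime field *)

Section LinearizedMaps.

Variables (F : finFieldType) (p : nat).
Hypothesis hp : p \in [pchar F].

Notation E := 'End(pPrimeCharType hp).

Definition induces (phi : E) (f : {poly F}) : Prop :=
  forall z : F, phi z = f.[z].

Lemma pchar_lfun : p \in [pchar E].
Proof. by rewrite pchar_lalg pchar_Fp // (pcharf_prime hp). Qed.

Lemma linearized_induces (q : nat) (f : {poly F}) :
  p.-nat q -> linearized q f -> exists phi : E, induces phi f.
Proof.
move=> qp [m [a ->]]; set g := (\sum_(_ <= _ < _) _).
have gD (x y : F) : g.[x + y] = g.[x] + g.[y].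
  rewrite !horner_sum -big_split; apply: eq_bigr => i _ /=.
  rewrite !hornerZ !hornerXn exprDn_pchar ?mulrDr //.
  by rewrite (eq_pnat _ (pcharf_eq hp)) pnatX qp.
have g0 : g.[0] = 0 by apply: (addrI g.[0]); rewrite -gD !addr0.
(* A scalar c of the prime field acts as multiplication by [c%:R], so additivity already gives
   linearity. *)
have gM (n : nat) (x : F) : g.[n%:R * x] = n%:R * g.[x].
  by elim: n => [|n IHn]; rewrite ?mul0r // mulrSr !mulrDl !mul1r gD IHn.
pose h (z : pPrimeCharType hp) : pPrimeCharType hp := g.[z].
have h_lin : linear h by move=> c x y; rewrite /h gD gM.
pose hL := GRing.isLinear.Build _ _ _ _ h h_lin.
pose hl : {linear _ -> _} := HB.pack h hL.
by exists (linfun hl) => z; rewrite (lfunE hl).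
Qed.

Lemma inducesX (phi : E) (f : {poly F}) (n : nat) :
  induces phi f -> induces (phi ^+ n) (poly_iter f n).
Proof.
move=> phif z; rewrite horner_poly_iter.
elim: n => [|n IHn]; first by rewrite id_lfunE.
by rewrite exprSr lfun_mulE IHn phif.
Qed.

Lemma inducesD (phi psi : E) (f g : {poly F}) :
  induces phi f -> induces psi g -> induces (phi + psi) (f + g).
Proof. by move=> phif psig z; rewrite add_lfunE phif psig hornerD. Qed.

Lemma induces1 : induces 1 'X.
Proof. by move=> z; rewrite id_lfunE hornerX. Qed.

Lemma induces_comm (phi psi : E) (f g : {poly F}) :
  induces phi f -> induces psi g -> f \Po g = g \Po f -> GRing.comm phi psi.
Proof.
move=> phif psig fg; apply/lfunP => z.
by rewrite !lfun_mulE !phif !psig -!horner_comp fg.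
Qed.

Lemma induces_eq1 (phi : E) (f : {poly F}) :
  induces phi f -> (forall z, f.[z] = z) <-> phi = 1.
Proof.
move=> phif; split=> [f1 | phi1 z]; last by rewrite -phif phi1 id_lfunE.
by apply/lfunP => z; rewrite phif f1 id_lfunE.
Qed.

(** The polynomial ['X^#|F| - 'X] is the product of all X - a with a in F, so its multiples are
    exactly the polynomials vanishing on F. *)
Lemma dvdp_induces0 (phi : E) (f : {poly F}) :
  induces phi f -> ('X^#|F| - 'X %| f) = (phi == 0).
Proof.
move=> phif; apply/idP/eqP => [/dvdpP[h fE] | phi0].
  apply/lfunP => z; rewrite phif fE zero_lfunE hornerM hornerD hornerN hornerXn.
  by rewrite hornerX expf_card subrr mulr0.
rewrite finField_genPoly -big_enum uniq_roots_dvdp //.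
  by apply/allP => z _; rewrite rootE -phif phi0 zero_lfunE.
by rewrite uniq_rootsE enum_uniq.
Qed.

Lemma perm_poly_order (phi : E) (f : {poly F}) :
    induces phi f -> perm_poly f ->
  (0 < pp_order f)%N /\
  forall d, (phi ^+ d == 1) = (pp_order f %| d)%N.
Proof.
move=> phif /pp_orderP[s_gt0 fs mins]; split=> // d.
apply: expr_eq1_dvdn => //; first exact/(induces_eq1 (inducesX _ phif)).
by move=> e e_gt0 /(induces_eq1 (inducesX _ phif)); apply: mins.
Qed.

End LinearizedMaps.

(** * Inverse and order of L + k *)

Section NilpotentPlusPermutation.

Variables (F : finFieldType) (p : nat) (L k : {poly F}).
Hypothesis hp : p \in [pchar F].
Variables (lE kE : 'End(pPrimeCharType hp)) (t : nat).
Hypotheses (lEL : induces lE L) (kEk : induces kE k).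
Hypotheses (lk : GRing.comm lE kE) (lt0 : lE ^+ t = 0).
Hypothesis hkperm : perm_poly k.

Lemma nilpotent_perm_inverse (s := pp_order k)
    (g := \sum_(0 <= i < t) (-1) ^+ i *:
       (poly_iter L i \Po
          poly_iter k `|((s%:Z - 1 - i%:Z) %% s%:Z)%Z|%N)) :
  cancel (fun x : F => (L + k).[x]) (fun x : F => g.[x]) /\
  cancel (fun x : F => g.[x]) (fun x : F => (L + k).[x]).
Proof.
have [s_gt0 kE1] := perm_poly_order kEk hkperm.
have [] := comm_nilpotent_inv (j := fun i =>
  `|((s%:Z - 1 - i%:Z) %% s%:Z)%Z|%N) lk lt0.
  by move=> i; apply/eqP; rewrite -exprD kE1 dvdn_absz_modz_sub.
set gE := \sum_(_ <= _ < _) _ => lkg glk.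
have gEg : induces gE g.
  move=> z; rewrite sum_lfunE horner_sum; apply: eq_bigr => i _.
  rewrite hornerZ horner_comp -(inducesX _ lEL) -(inducesX _ kEk).
  (* The product of endomorphisms applies its left factor first, whereas in [g] the iterate of [k]
     is applied before that of [L]. *)
  have -> a b : lE ^+ a * kE ^+ b = kE ^+ b * lE ^+ a.
    by apply: commrX; apply: commr_sym; apply: commrX; apply: commr_sym.
  rewrite -signr_odd -[in RHS]signr_odd; case: (odd i).
    by rewrite !expr1 !mulN1r opp_lfunE lfun_mulE.
  by rewrite !mul1r lfun_mulE.
have lkE := inducesD lEL kEk.
by split=> z; rewrite -?gEg -!lkE -?gEg -lfun_mulE (glk, lkg) id_lfunE.
Qed.

Lemma perm_poly_nilpotentD : perm_poly (L + k).
Proof. by have [lkK Klk] := nilpotent_perm_inverse; apply: (Bijective lkK Klk). Qed.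

Lemma pp_order_nilpotentD :
  (0 < t)%N -> (pp_order (L + k) %| lcmn (pp_order k) (p ^ up_log p t))%N.
Proof.
move=> t_gt0; have [_ kE1] := perm_poly_order kEk hkperm.
have [_ <-] := perm_poly_order (inducesD lEL kEk) perm_poly_nilpotentD.
have p_gt1 := prime_gt1 (pcharf_prime hp).
have /dvdnP[m mE] := dvdn_lcmr (pp_order k) (p ^ up_log p t).
rewrite mE mulnC exprM exprD_pchar_comm ?pchar_lfun //.
have -> : lE ^+ (p ^ up_log p t) = 0.
  by rewrite -(subnK (up_logP t p_gt1)) exprD lt0 mulr0.
by rewrite add0r -exprM mulnC -mE kE1 dvdn_lcml.
Qed.

End NilpotentPlusPermutation.

Lemma pp_order_square_zeroD (F : finFieldType) (p : nat) (L k : {poly F})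
    (hp : p \in [pchar F]) (lE kE : 'End(pPrimeCharType hp)) :
    induces lE L -> induces kE k -> GRing.comm lE kE ->
    lE ^+ 2 = 0 -> lE != 0 -> perm_poly k -> coprime (pp_order k) p ->
  pp_order (L + k) = (p * pp_order k)%N.
Proof.
move=> lEL kEk lk l2 l_neq0 hkperm s_p.
have p_pr := pcharf_prime hp; have p_gt1 := prime_gt1 p_pr.
have [s_gt0 kE1] := perm_poly_order kEk hkperm.
have hlk := perm_poly_nilpotentD lEL kEk lk l2 hkperm.
have [_ lkE1] := perm_poly_order (inducesD lEL kEk) hlk.
apply/eqP; rewrite eqn_dvd; apply/andP; split.
  have := pp_order_nilpotentD lEL kEk lk l2 hkperm isT.
  (* Since 1 < 2 <= p, the exponent e is 1, and lcm(s, p) = sp by coprimality. *)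
  have -> : up_log p 2 = 1%N.
    by apply/eqP; rewrite eqn_leq up_log_gt0 p_gt1 up_log_min.
  by rewrite expn1 /lcmn (eqP s_p) divn1 mulnC.
set d := pp_order (L + k).
have lkd : (lE + kE) ^+ d = 1 by apply/eqP; rewrite lkE1.
have s_d : (pp_order k %| d)%N.
  rewrite -(Gauss_dvdl _ s_p) -kE1; apply/eqP.
  (* As p >= 2, also l^p = 0, so (l + k)^p = k^p and k^(dp) = ((l + k)^d)^p = 1. *)
  have lp0 : lE ^+ p = 0 by rewrite -[X in _ ^+ X](subnK p_gt1) exprD l2 mulr0.
  have := exprD_pchar_comm lk 1 (pchar_lfun hp).
  rewrite expn1 lp0 add0r => lkp.
  by rewrite mulnC exprM -lkp -exprM mulnC exprM lkd expr1n.
have kd : kE ^+ d = 1 by apply/eqP; rewrite kE1.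
(* With (l + k)^d = k^d = 1, the expansion multiplied by k reads k = k + dl. *)
have ld0 : lE *+ d = 0.
  have := exprD_comm_sqr0 lk d l2.
  rewrite lkd exprS kd mul1r !mulr1 => /esym/(canRL (addKr _)).
  by rewrite addNr.
rewrite mulnC Gauss_dvd // s_d /=.
have /eqP := ld0; rewrite -scaler_nat scaler_eq0 (negPf l_neq0) orbF.
by rewrite -(dvdn_pcharf (pchar_Fp p_pr)).
Qed.

Theorem theorem3 (F : finFieldType) (q n p t s : nat) (L k : {poly F})
    (hq : prime_power q) (hn : (1 < n)%N) (hF : #|F| = (q ^ n)%N)
    (hp : p \in [pchar F]) (ht : (2 <= t)%N)
    (hL : NLP q t L)
    (hklin : linearized q k) (hkperm : perm_poly k)
    (hcomm : k \Po L = L \Po k)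
    (hs : s = pp_order k) :
  [/\ perm_poly (L + k) /\
      (let g := \sum_(0 <= i < t) (-1) ^+ i *:
          (poly_iter L i \Po
             poly_iter k `|((s%:Z - 1 - i%:Z) %% s%:Z)%Z|%N) in
       cancel (fun x : F => (L + k).[x]) (fun x : F => g.[x]) /\
       cancel (fun x : F => g.[x]) (fun x : F => (L + k).[x])),
      complete_perm_poly k -> complete_perm_poly (L + k),
      (pp_order (L + k) %| lcmn s (p ^ up_log p t))%N &
      t = 2%N -> coprime s p -> pp_order (L + k) = (p * s)%N].
Proof.
have qp : p.-nat q.
  case: hq => r [m [r_pr m_gt0 qE]].
  (* The cardinality of F is a power of r, so r is the characteristic, that is, r = p. *)
  have : r \in [pchar F].
    by apply: (@card_finPcharP _ _ (m * n)); rewrite // hF qE expnM.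
  rewrite (pcharf_eq hp) => /eqP pr.
  by rewrite qE pnatX pr pnat_id // (pcharf_prime hp).
case: hL => hLlin hL0 hLt.
have [lE lEL] := linearized_induces hp qp hLlin.
have [kE kEk] := linearized_induces hp qp hklin.
have lk : GRing.comm lE kE by apply: induces_comm lEL kEk _.
have lt0 : lE ^+ t = 0 by apply/eqP; rewrite -(dvdp_induces0 (inducesX t lEL)).
have l_neq0 : lE != 0 by rewrite -(dvdp_induces0 lEL).
subst s; split.
- split; first exact: perm_poly_nilpotentD lEL kEk lk lt0 hkperm.
  exact: nilpotent_perm_inverse lEL kEk lk lt0 hkperm.
- case=> _ hk1; split; first exact: perm_poly_nilpotentD lEL kEk lk lt0 hkperm.
  (* Regroup as L + (k + X): [kE + 1] induces k + X and commutes with [lE], so the permutation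
     result applies with k + X in place of k. *)
  rewrite -addrA.
  apply: perm_poly_nilpotentD lEL (inducesD kEk (induces1 hp)) _ lt0 hk1.
  by apply: commrD => //; apply: commr1.
- exact: pp_order_nilpotentD lEL kEk lk lt0 hkperm (ltnW ht).
by move=> t2; subst t; apply: pp_order_square_zeroD lEL kEk lk lt0 l_neq0 hkperm.
Qed.
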